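(* There is an absolute constant $\alpha>0$ such that the following holds. Let $\mathcal{G}=(X,Y,E,\Sigma_X,\Sigma_Y,\{P_{(x,y)}\})$ be any two-prover game whose question distribution is uniform over the edge set $E\subseteq X\times Y$, let $d_{max}$ be the maximum degree of a vertex in the bipartite graph $(X,Y,E)$, let $val(\mathcal{G})=1-\varepsilon$, and let $c=\log(|\Sigma_X||\Sigma_Y|)$. Then for all integers $0\le k\le |X|$ and $0\le l\le |Y|$, $$val(\mathcal{G}^{k\times l})\le 2(1-\varepsilon/2)^{\frac{\alpha\varepsilon^5 kl|E|}{d_{max}|X||Y|c^2}}.$$
   Context: A two-prover game $\mathcal{G}=(X,Y,\mathcal{Q},\Sigma_X,\Sigma_Y,\{P_{(x,y)}\})$ consists of finite question sets $X,Y$, answer sets $\Sigma_X,\Sigma_Y$, a distribution $\mathcal{Q}$ on $X\times Y$, and predicates $P_{(x,y)}:\Sigma_X\times\Sigma_Y\to\{0,1\}$. Its value is $val(\mathcal{G})=\max_{\phi}\mathbb{E}_{(x,y)\sim\mathcal{Q}}[P_{(x,y)}(\phi(x),\phi(y))]$ over all strategies $\phi$ mapping $X\to\Sigma_X$ and $Y\to\Sigma_Y$. The $(k\times l)$-birthday repetition $\mathcal{G}^{k\times l}$ is the two-prover game whose question sets are $\binom{X}{k}$ (subsets of $X$ of size $k$) and $\binom{Y}{l}$, whose question distribution is uniform over $\binom{X}{k}\times\binom{Y}{l}$, whose answer sets are $\Sigma_X^k,\Sigma_Y^l$ (assignments to the elements of the question set), and whose predicate is $P^{k\times l}_{(S,T)}((\sigma_x)_{x\in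 S},(\sigma_y)_{y\in T})=\prod_{(x,y)\in(S\times T)\cap\mathrm{supp}(\mathcal{Q})}P_{(x,y)}(\sigma_x,\sigma_y)$ (an empty product equals $1$). $\log$ denotes the natural logarithm. *)

(* Defs.v *)
From HB Require Import structures.
From mathcomp Require Import all_boot all_order all_algebra.
From mathcomp Require Import all_classical all_reals.
From mathcomp Require Import exp.
From mathcomp Require Import Rstruct.
From Stdlib Require Import Reals.

Set Implicit Arguments.
Unset Strict Implicit.
Unset Printing Implicit Defensive.

Import Order.TTheory GRing.Theory Num.Theory.
Local Open Scope ring_scope.

(* Value of a two-prover game whose question distribution is uniform over the
   set Q of question pairs (Q is the support of the distribution), with
   (0/1-valued, i.e. boolean) predicates V qx qy ax ay.  The value is the
   maximum, over all strategies f : QX -> AX, g : QY -> AY, of the success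
   probability.  (Maxima of nonnegative reals, so the seed 0 is harmless.) *)
Definition uval (QX QY AX AY : finType) (Q : {set QX * QY})
    (V : QX -> QY -> AX -> AY -> bool) : R :=
  \big[Num.max/0]_(f : {ffun QX -> AX})
   \big[Num.max/0]_(g : {ffun QY -> AY})
     ((\sum_(q in Q) (V q.1 q.2 (f q.1) (g q.2))%:R) / (#|Q|%:R)).

Definition game_val (X Y SX SY : finType) (E : {set X * Y})
    (P : X -> Y -> SX -> SY -> bool) : R := uval E P.

(* (k x l)-birthday repetition: questions are k-subsets S of X and l-subsets
   T of Y (uniform over all such pairs); an answer to S is an assignment of an
   element of SX to each x (only the values on S matter, as answers are
   assignments to the elements of S); the predicate is the product (= boolean
   conjunction) of P over (S x T) ∩ supp(Q) = (S x T) ∩ E. *)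
Definition birthday_pred (X Y SX SY : finType) (E : {set X * Y})
    (P : X -> Y -> SX -> SY -> bool)
    (S : {set X}) (T : {set Y}) (a : {ffun X -> SX}) (b : {ffun Y -> SY}) : bool :=
  [forall e in E, ((e.1 \in S) && (e.2 \in T)) ==> P e.1 e.2 (a e.1) (b e.2)].

Definition birthday_questions (X Y : finType) (k l : nat) : {set {set X} * {set Y}} :=
  [set q : {set X} * {set Y} | (#|q.1| == k) && (#|q.2| == l)].

Definition birthday_val (X Y SX SY : finType) (E : {set X * Y})
    (P : X -> Y -> SX -> SY -> bool) (k l : nat) : R :=
  uval (birthday_questions X Y k l) (birthday_pred E P).

Definition dmax (X Y : finType) (E : {set X * Y}) : nat :=
  maxn (\max_(x : X) #|[set y : Y | (x, y) \in E]|)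
       (\max_(y : Y) #|[set x : X | (x, y) \in E]|).

(* Main.v *)
(* Replace the random k-set and l-set by Bernoulli sets S and T of half the
   expected size (a random extension shows that this loses a factor 4). Since S
   and T are independent, conditioning on a rectangle A x B of probability at
   least exp (- h) keeps them independent, and by entropy the vertex marginals,
   weighted by degree, move little as long as h is at most a constant times
   eps^2 k l |E| / (d_max |X| |Y|). Asking a planted edge under this conditioning
   therefore simulates a strategy for the one-round game, so it is answered
   correctly with probability at most 1 - eps / 2. Revealing planted edges one
   after the other loses this factor each time, while each revealed answer pair
   shrinks the rectangle by a factor of at most |SX| |SY| on average; hence about
   h / log (|SX| |SY|) edges can be revealed. This gives the exponent
   eps^3 k l |E| / (d_max |X| |Y| c), which dominates the stated one. *)
Require Import Defs.
From HB Require Import structures.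
From mathcomp Require Import all_boot all_order all_algebra.
From mathcomp Require Import all_classical all_reals.
From mathcomp Require Import exp.
From mathcomp Require Import Rstruct.
From Stdlib Require Import Reals.
From mathcomp Require Import ring lra.
From mathcomp Require Import sequences Rstruct_topology.
Import Order.TTheory GRing.Theory Num.Theory.
Local Open Scope ring_scope.

Set Implicit Arguments.
Unset Strict Implicit.
Unset Printing Implicit Defensive.

(** * Exponential inequalities, the entropy bound and best responses *)

(** Since [expR (- z) >= 1 - z], it suffices that the polynomial times [1 - z] is at least 1; the
    excess is [z ^+ 2 * (1 - 2 * z)]. *)
Lemma expR_le_quad (R : realType) (z : R) : z <= 1 / 2 -> expR z <= 1 + z + 2 * z ^+ 2.
Proof.
move=> hz; have h1 : 1 - z <= expR (- z) by exact: expR_ge1Dx.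
have hE : expR z * expR (- z) = 1 by rewrite expRxMexpNx_1.
have hp : 0 < expR z by exact: expR_gt0.
have h2 : expR z * (1 - z) <= 1 by rewrite -[leRHS]hE ler_pM2l.
have h3 : 1 <= (1 + z + 2 * z ^+ 2) * (1 - z).
  have : 0 <= z ^+ 2 * (1 - 2 * z) by rewrite mulr_ge0 ?sqr_ge0//; lra.
  by rewrite !expr2; nra.
have hz1 : 0 < 1 - z by lra.
by rewrite -(ler_pM2r hz1); apply: le_trans h2 h3.
Qed.

Lemma expR_le_quad_neg (R : realType) (z : R) : z <= 0 -> expR z <= 1 + z + z ^+ 2.
Proof.
move=> hz; have h1 : 1 - z <= expR (- z) by exact: expR_ge1Dx.
have hE : expR z * expR (- z) = 1 by rewrite expRxMexpNx_1.
have hp : 0 < expR z by exact: expR_gt0.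
have h2 : expR z * (1 - z) <= 1 by rewrite -[leRHS]hE ler_pM2l.
have h3 : 1 <= (1 + z + z ^+ 2) * (1 - z).
  have : 0 <= z ^+ 2 * (- z) by rewrite mulr_ge0 ?sqr_ge0//; lra.
  by rewrite !expr2; nra.
have hz1 : 0 < 1 - z by lra.
by rewrite -(ler_pM2r hz1); apply: le_trans h2 h3.
Qed.

(* Donsker-Varadhan: conditioning on an event of probability at least [exp (- h)]
   raises the mean of [F] to at most [h] plus its log-moment generating function. *)
Lemma gibbs (R : realType) (T : finType) (w F : T -> R) (A : pred T) (h M : R) :
  (forall t, 0 <= w t) -> expR (- h) <= \sum_(t | A t) w t ->
  \sum_t w t * expR (F t) <= expR M ->
  \sum_(t | A t) w t * F t <= (\sum_(t | A t) w t) * (h + M).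
Proof.
move=> w0 hA hM.
have : \sum_(t | A t) w t * (1 + (F t - (h + M))) <= expR (- h).
  apply: (@le_trans _ _ (\sum_t w t * expR (F t) * expR (- (h + M)))).
    rewrite big_mkcond /=; apply: ler_sum => t _; case: ifP => _.
      by rewrite -mulrA -exp.expRD ler_wpM2l// expR_ge1Dx.
    by rewrite !mulr_ge0 ?expR_ge0.
  rewrite -mulr_suml; apply: (@le_trans _ _ (expR M * expR (- (h + M)))).
    by rewrite ler_pM2r ?expR_gt0.
  by rewrite -exp.expRD; have -> : M - (h + M) = - h by ring.
have -> : \sum_(t | A t) w t * (1 + (F t - (h + M))) =
   \sum_(t | A t) w t * F t + (\sum_(t | A t) w t) * (1 - (h + M)).
  by rewrite mulr_suml -big_split /=; apply: eq_bigr => t _; ring.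
by move=> H; move: (le_trans H hA); lra.
Qed.

(** Moving all the weight of row [i] to a maximiser of [F i] cannot lower the sum. This derandomises
    strategies and, later, random supersets. *)
Lemma best_response (R : realType) (I J : finType) (p F : I -> J -> R) (m : I -> R) :
  leq 1 #|J| -> (forall i j, 0 <= p i j) -> (forall i, \sum_j p i j <= m i) ->
  (forall i j, 0 <= F i j) ->
  exists f : {ffun I -> J}, \sum_i \sum_j p i j * F i j <= \sum_i m i * F i (f i).
Proof.
move=> /card_gt0P [j0 _] p0 pm F0.
exists [ffun i => [arg max_(j > j0) F i j]%O].
apply: ler_sum => i _; rewrite ffunE.
case: arg_maxP => // j _ hj.
apply: (@le_trans _ _ (\sum_k p i k * F i j)).
  by apply: ler_sum => k _; rewrite ler_wpM2l//; apply: hj.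
by rewrite -mulr_suml ler_wpM2r.
Qed.

(** * Random subsets with independent elements *)

Definition bern (R : realType) (I : finType) (q : R) (S : {set I}) : R :=
  \prod_i (if i \in S then q else 1 - q).

Lemma bern_ge0 (R : realType) (I : finType) (q : R) (S : {set I}) :
  0 <= q <= 1 -> 0 <= bern q S.
Proof.
by move=> /andP[q0 q1]; apply: prodr_ge0 => i _; case: ifP => _ //; rewrite subr_ge0.
Qed.

Lemma bern_prod (R : realType) (I : finType) (q : R) (u : I -> R) :
  \sum_(S : {set I}) bern q S * \prod_(i in S) u i = \prod_i (q * u i + (1 - q)).
Proof.
rewrite bigA_distr; apply: eq_bigr => S _; rewrite /bern.
rewrite [X in _ * X]big_mkcond -big_split /=; apply: eq_bigr => i _.
by case: ifP => _; rewrite ?mulr1.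
Qed.

Lemma bern_sum1 (R : realType) (I : finType) (q : R) : \sum_(S : {set I}) bern q S = 1.
Proof.
have := @bern_prod R I q (fun=> 1).
rewrite [RHS]big1 => [<-|i _]; last by rewrite mulr1; ring.
by apply: eq_bigr => S _; rewrite big1 // mulr1.
Qed.

(** By independence the left side is a product of factors [1 + q * (expR (w i) - 1)], each at most
    its exponential: the Poisson bound. *)
Lemma bern_mgf (R : realType) (I : finType) (q : R) (w : I -> R) : 0 <= q <= 1 ->
  \sum_(S : {set I}) bern q S * expR (\sum_(i in S) w i) <=
    expR (q * \sum_i (expR (w i) - 1)).
Proof.
move=> /andP[q0 q1].
under eq_bigr do rewrite expR_sum.
rewrite bern_prod mulr_sumr expR_sum; apply: ler_prod => i _.
apply/andP; split.
  by rewrite addr_ge0 ?mulr_ge0 ?expR_ge0 ?subr_ge0.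
have := expR_ge1Dx (q * (expR (w i) - 1)).
by apply: le_trans; rewrite mulrBr; lra.
Qed.

(** Given [x \in S], the rest of [S] is still Bernoulli, so adding [x] to a fresh set reproduces the
    conditional law. *)
Lemma bern_plant (R : realType) (I : finType) (q : R) (x : I) (g : {set I} -> R) :
  \sum_(S : {set I} | x \in S) bern q S * g S = q * \sum_(S : {set I}) bern q S * g (x |: S).
Proof.
have bernx (S : {set I}) : x \in S ->
    q * bern q (S :\ x) = (1 - q) * bern q S.
  move=> xS; rewrite /bern !(bigD1 x (P := predT)) //= xS finset.setD11 mulrCA; congr (_ * (_ * _)).
  by apply: eq_bigr => i ix; rewrite finset.in_setD1 ix.
rewrite [in RHS](bigID (fun S : {set I} => x \in S)) /= mulrDr.
have -> : \sum_(S : {set I} | x \in S) bern q S * g (x |: S) =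
          \sum_(S : {set I} | x \in S) bern q S * g S.
  by apply: eq_bigr => S xS; rewrite (finset.setUidPr _) // finset.sub1set.
suff -> : q * \sum_(S : {set I} | x \notin S) bern q S * g (x |: S) =
          (1 - q) * \sum_(S : {set I} | x \in S) bern q S * g S by ring.
(* Pair each set without [x] with the set that has [x] added; the weights differ by the factor
   [(1 - q) / q], which is [bernx]. *)
rewrite (reindex_onto (fun S : {set I} => S :\ x) (fun S => x |: S)) /=; last first.
  by move=> S xS; rewrite finset.setU1K.
rewrite !mulr_sumr; apply: eq_big => S.
  rewrite finset.setD11 /=; apply/eqP/idP => [<-|xS]; first by rewrite finset.setU11.
  by rewrite finset.setD1K.
by rewrite finset.setD11 /= => /eqP hS; rewrite hS !mulrA bernx // -hS finset.setU11.
Qed.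

(** * Randomised strategies in the one-round game *)

Lemma sum_edges (R : realType) (X Y : finType) (E : {set X * Y}) (F : X -> Y -> R) :
  \sum_(e in E) F e.1 e.2 = \sum_x \sum_y ((x, y) \in E)%:R * F x y.
Proof.
rewrite pair_big /= big_mkcond; apply: eq_bigr => -[x y] _ /=.
by case: ifP => _; rewrite ?mul1r ?mul0r.
Qed.

(** The winning weight is linear in each prover's randomness, so [best_response] fixes [f] against
    [p'] and then [g] against [f]. Row sums at most 1 suffice, so marginals truncated at 1
    qualify. *)
Lemma value_ge_random (R : realType) (X Y SX SY : finType) (E : {set X * Y})
    (P : X -> Y -> SX -> SY -> bool) (v : R) (p : X -> SX -> R) (p' : Y -> SY -> R) :
  leq 1 #|SX| -> leq 1 #|SY| ->
  (forall (f : {ffun X -> SX}) (g : {ffun Y -> SY}),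
     \sum_(e in E) (P e.1 e.2 (f e.1) (g e.2))%:R <= v) ->
  (forall x s, 0 <= p x s) -> (forall y t, 0 <= p' y t) ->
  (forall x, \sum_s p x s <= 1) -> (forall y, \sum_t p' y t <= 1) ->
  \sum_(e in E) \sum_s \sum_t p e.1 s * p' e.2 t * (P e.1 e.2 s t)%:R <= v.
Proof.
move=> SX0 SY0 hv p0 p0' p1 p1'.
pose F x s := \sum_y \sum_t ((x, y) \in E)%:R * p' y t * (P x y s t)%:R.
have F0 x s : 0 <= F x s.
  by apply: sumr_ge0 => y _; apply: sumr_ge0 => t _; rewrite !mulr_ge0.
have [f hf] := best_response SX0 p0 p1 F0.
pose G y t := \sum_x ((x, y) \in E)%:R * (P x y (f x) t)%:R : R.
have G0 y t : 0 <= G y t by apply: sumr_ge0 => x _; rewrite mulr_ge0.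
have [g hg] := best_response SY0 p0' p1' G0.
apply: le_trans (hv f g).
rewrite (sum_edges E (fun x y => \sum_s \sum_t p x s * p' y t * (P x y s t)%:R)).
rewrite (sum_edges E (fun x y => (P x y (f x) (g y))%:R)).
have -> : \sum_x \sum_y ((x, y) \in E)%:R *
    (\sum_s \sum_t p x s * p' y t * (P x y s t)%:R) = \sum_x \sum_s p x s * F x s.
  apply: eq_bigr => x _; under [RHS]eq_bigr do rewrite mulr_sumr.
  rewrite exchange_big /=; apply: eq_bigr => y _; rewrite mulr_sumr.
  apply: eq_bigr => s _; rewrite !mulr_sumr; apply: eq_bigr => t _; ring.
apply: le_trans hf _.
have -> : \sum_x 1 * F x (f x) = \sum_y \sum_t p' y t * G y t.
  under eq_bigr do rewrite mul1r.
  rewrite exchange_big /=; apply: eq_bigr => y _; rewrite exchange_big /=.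
  apply: eq_bigr => t _; rewrite mulr_sumr; apply: eq_bigr => x _; ring.
apply: le_trans hg _.
rewrite exchange_big /=; apply: ler_sum => x _.
by rewrite mul1r.
Qed.

(** * One round against provers whose marginals have small entropy *)

(** For nonnegative [a], [hu] is the dual form of the entropy bound that [q] times the sum of
    [a ln a - a + 1] is at most [h]. It is tested with [- lam * w] where [a] is below 1 and 0
    elsewhere; the second-order term of the exponential gives [lam ^+ 2]. *)
Lemma tilt_lower (R : realType) (I : finType) (a w : I -> R) (q h lam : R) :
  0 <= q -> 0 < lam <= 1 -> (forall i, 0 <= w i <= 1) ->
  (forall u : I -> R, q * (\sum_i a i * u i) <= h + q * \sum_i (expR (u i) - 1)) ->
  lam * (q * \sum_i (1 - Num.min (a i) 1) * w i) <= h + lam ^+ 2 * (q * \sum_i w i).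
Proof.
move=> q0 /andP[l0 l1] w01 hu.
have := hu (fun i => if a i < 1 then - (lam * w i) else 0).
rewrite -lerBlDr -mulrBr -sumrB -lerBlDr => H; apply: le_trans H.
rewrite [leLHS](_ : _ = q * \sum_i (lam * ((1 - Num.min (a i) 1) * w i) - lam ^+ 2 * w i));
  last by rewrite sumrB -!mulr_sumr; ring.
rewrite ler_wpM2l//; apply: ler_sum => i _.
have /andP[wi0 wi1] := w01 i.
have lw0 : 0 <= lam * w i by rewrite mulr_ge0// ltW.
case: ltP => hi; last by rewrite mulr0 exp.expR0 subrr subrr mul0r mulr0 add0r oppr_le0 mulr_ge0// sqr_ge0.
have hz : - (lam * w i) <= 0 by rewrite oppr_le0.
have := expR_le_quad_neg hz.
have : lam ^+ 2 * (w i * (1 - w i)) >= 0 by rewrite mulr_ge0 ?sqr_ge0 ?mulr_ge0 ?subr_ge0.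
rewrite sqrrN exprMn !expr2; lra.
Qed.

Lemma tilt_upper (R : realType) (I : finType) (a w : I -> R) (q h lam : R) :
  0 <= q -> 0 < lam <= 1 / 2 -> (forall i, 0 <= w i <= 1) ->
  (forall u : I -> R, q * (\sum_i a i * u i) <= h + q * \sum_i (expR (u i) - 1)) ->
  lam * (q * \sum_i a i * w i) <= h + (lam + 2 * lam ^+ 2) * (q * \sum_i w i).
Proof.
move=> q0 /andP[l0 l1] w01 hu.
have := hu (fun i => lam * w i).
rewrite [in X in X -> _](_ : \sum_i a i * (lam * w i) = lam * \sum_i a i * w i); last first.
  by rewrite mulr_sumr; apply: eq_bigr => i _; ring.
rewrite mulrCA => H; apply: (le_trans H); rewrite lerD2l mulrCA ler_wpM2l// mulr_sumr.
apply: ler_sum => i _; have /andP[wi0 wi1] := w01 i.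
have hz : lam * w i <= 1 / 2 by apply: le_trans l1; rewrite ler_piMr// ltW.
have := expR_le_quad hz.
have : lam ^+ 2 * (w i * (1 - w i)) >= 0 by rewrite mulr_ge0 ?sqr_ge0 ?mulr_ge0 ?subr_ge0.
rewrite exprMn !expr2; lra.
Qed.

Lemma marginal_deficit (R : realType) (I : finType) (a D : I -> R) (eps q q' h d n : R) :
  0 < eps <= 1 -> 0 < q -> q' <= 1 / 2 -> 0 < d -> 0 < n ->
  (forall i, 0 <= D i <= d) -> \sum_i D i = n ->
  h * d = eps ^+ 2 * (q * q' * n) / 40 ^+ 2 ->
  (forall u : I -> R, q * (\sum_i a i * u i) <= h + q * \sum_i (expR (u i) - 1)) ->
  \sum_i (1 - Num.min (a i) 1) * D i <= eps / 8 * n.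
Proof.
move=> /andP[e0 e1] q0 q1' d0 n0 hD nD hh hA.
(* Relative to [n], the deficit is of order [eps ^+ 2 / lam + lam], so [lam] proportional to [eps]
   balances the terms; 48 brings their sum below [eps / 8]. *)
pose lam := eps / 48.
have l01 : 0 < lam <= 1 by rewrite /lam; apply/andP; split; lra.
have dn : d != 0 by rewrite gt_eqF.
have wD i : 0 <= D i / d <= 1.
  by have /andP[D0 D1] := hD i; rewrite divr_ge0 ?(ltW d0)//= ler_pdivrMr// mul1r.
have := tilt_lower (ltW q0) l01 wD hA.
rewrite -mulr_suml nD -(ler_pM2r d0) mulrDl hh.
under eq_bigr do rewrite mulrA.
rewrite -mulr_suml; set T := \sum_i _ * D i.
rewrite [leLHS](_ : _ = q * (lam * T)); last by field.
rewrite [leRHS](_ : _ = q * (eps ^+ 2 * n * q' / 40 ^+ 2 + lam ^+ 2 * n)); last by field.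
rewrite ler_pM2l// => H.
have e2n : 0 < eps ^+ 2 * n by rewrite mulr_gt0 ?exprn_gt0.
have : eps ^+ 2 * n * q' <= eps ^+ 2 * n * (1 / 2) by rewrite ler_pM2l.
move=> H1; have H2 : eps * (T / 48) <= eps * (eps * n * (1 / (2 * 40 ^+ 2) + 1 / 48 ^+ 2)).
  rewrite [leLHS](_ : _ = lam * T); last by rewrite /lam; field.
  apply: le_trans H _; rewrite [leRHS](_ : _ = eps ^+ 2 * n * (1 / 2) / 40 ^+ 2 + lam ^+ 2 * n); last by rewrite /lam; field.
  by lra.
rewrite ler_pM2l// in H2.
have : 0 < eps * n by rewrite mulr_gt0.
by rewrite mulrAC; move: H2; set z := eps * n; lra.
Qed.

(* [al x s] and [be y t] are the densities of "x is asked and answered by s" and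
   "y is asked and answered by t" under two independent conditioned provers.
   Truncating both marginals at 1 turns them into a randomized strategy for the
   one-round game; the truncation error is controlled by [hA] and [hB]. *)
Lemma rectangle_step (R : realType) (X Y SX SY : finType) (E : {set X * Y})
    (P : X -> Y -> SX -> SY -> bool) (eps q q' h d : R)
    (al : X -> SX -> R) (be : Y -> SY -> R) :
  leq 1 #|SX| -> leq 1 #|SY| -> 0 < eps <= 1 -> 0 < q <= 1 / 2 -> 0 < q' <= 1 / 2 ->
  (forall (f : {ffun X -> SX}) (g : {ffun Y -> SY}),
     \sum_(e in E) (P e.1 e.2 (f e.1) (g e.2))%:R <= (1 - eps) * #|E|%:R) ->
  0 < d -> (0 < #|E|%:R :> R) ->
  (forall x, \sum_y ((x, y) \in E)%:R <= d) ->
  (forall y, \sum_x ((x, y) \in E)%:R <= d) ->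
  h * d = eps ^+ 2 * (q * q' * #|E|%:R) / 40 ^+ 2 ->
  (forall x s, 0 <= al x s) -> (forall y t, 0 <= be y t) ->
  (forall u : X -> R, q * (\sum_x (\sum_s al x s) * u x) <= h + q * \sum_x (expR (u x) - 1)) ->
  (forall u : Y -> R, q' * (\sum_y (\sum_t be y t) * u y) <= h + q' * \sum_y (expR (u y) - 1)) ->
  (forall y, q' * \sum_t be y t <= 1) ->
  \sum_(e in E) \sum_s \sum_t al e.1 s * be e.2 t * (P e.1 e.2 s t)%:R <=
    (1 - eps / 2) * #|E|%:R.
Proof.
move=> SX0 SY0 /andP[e0 e1] /andP[q0 q1] /andP[q0' q1'] hv d0 En0 hdX hdY hh al0 be0 hA hB hB1.
set n : R := #|E|%:R in hv En0 hh *.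
pose a x := \sum_s al x s; pose b y := \sum_t be y t.
have a0 x : 0 <= a x by apply: sumr_ge0.
have b0 y : 0 <= b y by apply: sumr_ge0.
pose dX x : R := \sum_y ((x, y) \in E)%:R.
pose dY y : R := \sum_x ((x, y) \in E)%:R.
have dX0 x : 0 <= dX x by apply: sumr_ge0.
have dY0 y : 0 <= dY y by apply: sumr_ge0.
have sumX (F : X -> R) : \sum_(e in E) F e.1 = \sum_x F x * dX x.
  rewrite (sum_edges E (fun x y => F x)); apply: eq_bigr => x _.
  by rewrite -mulr_suml mulrC.
have sumY (F : Y -> R) : \sum_(e in E) F e.2 = \sum_y F y * dY y.
  rewrite (sum_edges E (fun x y => F y)) exchange_big; apply: eq_bigr => y _.
  by rewrite -mulr_suml mulrC.
have ndX : \sum_x dX x = n.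
  by have := sumX (fun=> 1); rewrite sumr_const -/n => ->; apply: eq_bigr => x _; rewrite mul1r.
have ndY : \sum_y dY y = n.
  by have := sumY (fun=> 1); rewrite sumr_const -/n => ->; apply: eq_bigr => x _; rewrite mul1r.
have wY y : 0 <= dY y / d <= 1.
  by rewrite divr_ge0 ?(ltW d0)//= ler_pdivrMr// mul1r; apply: hdY.
have swY : \sum_y dY y / d = n / d by rewrite -mulr_suml ndY.
pose lam := eps / 48.
have l01 : 0 < lam <= 1 by rewrite /lam; apply/andP; split; lra.
have l02 : 0 < lam <= 1 / 2 by rewrite /lam; apply/andP; split; lra.
have q0w := ltW q0; have q0w' := ltW q0'.
have dn : d != 0 by rewrite gt_eqF.
have low1 : \sum_(e in E) (1 - Num.min (a e.1) 1) <= eps / 8 * n.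
  rewrite (sumX (fun x => 1 - Num.min (a x) 1)).
  by apply: (marginal_deficit (q := q) (q' := q') (h := h) (d := d)); rewrite ?e0 // => x; rewrite dX0 hdX.
have low2 : \sum_(e in E) (1 - Num.min (b e.2) 1) <= eps / 8 * n.
  rewrite (sumY (fun x => 1 - Num.min (b x) 1)).
  apply: (marginal_deficit (q := q') (q' := q) (h := h) (d := d)); rewrite ?e0 //.
  - by move=> y; rewrite dY0 hdY.
  - by rewrite hh; ring.
have upb : lam * (\sum_(e in E) b e.2) <= eps ^+ 2 * q * n / 40 ^+ 2 + (lam + 2 * lam ^+ 2) * n.
  rewrite sumY.
  have := tilt_upper q0w' l02 wY hB.
  rewrite swY -(ler_pM2r d0) mulrDl hh.
  under eq_bigr do rewrite mulrA.
  rewrite -mulr_suml -/b; set T := \sum_x _ * dY x.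
  rewrite [leLHS](_ : _ = q' * (lam * T)); last by field.
  rewrite [leRHS](_ : _ = q' * (eps ^+ 2 * q * n / 40 ^+ 2 + (lam + 2 * lam ^+ 2) * n)); last by field.
  by rewrite ler_pM2l.
have up : \sum_(e in E) a e.1 * b e.2 <= (1 + eps / 4) * n.
  (* [q' * b y] is at most 1 by [hB1], so [om] is an admissible weight. The upper tilt for [a] with
     this weight, composed with [upb], controls the product [a * b] along edges. *)
  pose om x := q' * (\sum_y ((x, y) \in E)%:R * b y) / d.
  have om01 x : 0 <= om x <= 1.
    have s0 : 0 <= \sum_y ((x, y) \in E)%:R * b y by apply: sumr_ge0 => y _; rewrite mulr_ge0.
    rewrite /om divr_ge0 ?(ltW d0) ?mulr_ge0 //=.
    rewrite ler_pdivrMr// mul1r; apply: le_trans (hdX x).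
    rewrite mulr_sumr; apply: ler_sum => y _; rewrite mulrCA ler_piMr//.
    exact: hB1.
  have := tilt_upper q0w l02 om01 hA.
  have -> : \sum_x om x = q' * (\sum_(e in E) b e.2) / d.
    rewrite (sum_edges E (fun x y => b y)) mulr_sumr mulr_suml.
    by apply: eq_bigr => x _.
  have -> : \sum_x (\sum_s al x s) * om x = q' * (\sum_(e in E) a e.1 * b e.2) / d.
    rewrite (sum_edges E (fun x y => a x * b y)) mulr_sumr mulr_suml.
    apply: eq_bigr => x _; rewrite /om -/(a x).
    rewrite [RHS](_ : _ = q' * (a x * \sum_y ((x, y) \in E)%:R * b y) / d); last first.
      by congr (_ * _ / _); rewrite mulr_sumr; apply: eq_bigr => y _; rewrite mulrCA.
    by ring.
  move: upb; set U := \sum_(e in E) b _; set T := \sum_(e in E) _ => upb.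
  rewrite -(ler_pM2r d0) mulrDl hh.
  rewrite [leLHS](_ : _ = (q * q') * (lam * T)); last by field.
  rewrite [leRHS](_ : _ = (q * q') * (eps ^+ 2 * n / 40 ^+ 2 + (1 + 2 * lam) * (lam * U))); last by field.
  rewrite ler_pM2l ?mulr_gt0// => H.
  have e2n : 0 < eps ^+ 2 * n by rewrite mulr_gt0 ?exprn_gt0.
  have {}upb : lam * U <= eps ^+ 2 * n / (2 * 40 ^+ 2) + (lam + 2 * lam ^+ 2) * n.
    apply: le_trans upb _; rewrite lerD2r.
    have : eps ^+ 2 * n * q <= eps ^+ 2 * n * (1 / 2) by rewrite ler_pM2l.
    by lra.
  have l0 : 0 < 1 + 2 * lam by case/andP: l01; lra.
  rewrite -(ler_pM2l l0) in upb.
  have {H upb} := le_trans H (lerD (lexx _) upb).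
  rewrite /lam [leLHS](_ : _ = eps * (T / 48)); last by field.
  set Z := leRHS.
  have -> : Z = eps * (n / 48 + eps * n * (1 / 40 ^+ 2 + 1 / (2 * 40 ^+ 2) + 4 / 48 / 48) + eps ^+ 2 * n * (1 / 40 ^+ 2 / 48 + 4 / 48 / 48 / 48)).
    by rewrite /Z; field.
  rewrite ler_pM2l//.
  have : eps ^+ 2 * n <= eps * n by rewrite ler_pM2r// expr2 ler_piMr// ltW.
  have : 0 < eps * n by rewrite mulr_gt0.
  rewrite (_ : (1 + eps / 4) * n = n + eps * n / 4); last by field.
  by set z1 := eps * n; set z2 := eps ^+ 2 * n; lra.
(* The factor that truncates a marginal [c] to [min c 1]; the branch [c <= 1] includes [c = 0], so
   nothing is divided by 0. *)
pose rh (c : R) := if c <= 1 then 1 else c^-1.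
have rh0 c : 0 <= c -> 0 <= rh c.
  by rewrite /rh; case: ifP => // _; rewrite invr_ge0.
have rh1 c : 0 <= c -> rh c <= 1.
  rewrite /rh => _; case: (leP c 1) => // c1.
  by rewrite invf_le1 ?ltW// (lt_trans ltr01).
have rhM c : 0 <= c -> c * rh c = Num.min c 1.
  rewrite /rh => _; case: (leP c 1) => c1; first by rewrite mulr1.
  by rewrite mulfV// gt_eqF// (lt_trans ltr01).
pose p x s := al x s * rh (a x); pose p' y t := be y t * rh (b y).
have sp x : \sum_s p x s = Num.min (a x) 1 by rewrite -mulr_suml rhM; last exact: a0.
have sp' y : \sum_t p' y t = Num.min (b y) 1 by rewrite -mulr_suml rhM; last exact: b0.
have p0 x s : 0 <= p x s by apply: mulr_ge0 => //; apply: rh0.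
have p0' y t : 0 <= p' y t by apply: mulr_ge0 => //; apply: rh0.
have p1 x : \sum_s p x s <= 1 by rewrite sp ge_min lexx orbT.
have p1' y : \sum_t p' y t <= 1 by rewrite sp' ge_min lexx orbT.
have hval := value_ge_random SX0 SY0 hv p0 p0' p1 p1'.
(* [p * p'] is below [al * be] and the predicate is at most 1, so truncation costs each edge at most
   the difference of the total masses. *)
apply: (@le_trans _ _ (\sum_(e in E) (\sum_s \sum_t p e.1 s * p' e.2 t * (P e.1 e.2 s t)%:R +
   (a e.1 * b e.2 - Num.min (a e.1) 1 * Num.min (b e.2) 1)))).
  apply: ler_sum => -[x y] _ /=.
  rewrite -sp -sp' !big_distrlr /= -sumrB -big_split /=; apply: ler_sum => s _.
  rewrite -sumrB -big_split /=; apply: ler_sum => t _.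
  have : p x s * p' y t <= al x s * be y t.
    by rewrite ler_pM// ler_piMr// rh1.
  by case: (P _ _ _ _); rewrite ?mulr1 ?mulr0; lra.
rewrite big_split /=.
have h2 : \sum_(e in E) (a e.1 * b e.2 - Num.min (a e.1) 1 * Num.min (b e.2) 1) <=
  \sum_(e in E) (a e.1 * b e.2 + (1 - Num.min (a e.1) 1) + (1 - Num.min (b e.2) 1) - 1).
  have aux (u m1 m2 : R) : m1 <= 1 -> m2 <= 1 ->
      u - m1 * m2 <= u + (1 - m1) + (1 - m2) - 1.
    move=> h1 h2; have : 0 <= (1 - m1) * (1 - m2) by rewrite mulr_ge0 // subr_ge0.
    by lra.
  by apply: ler_sum => -[x y] _ /=; apply: aux; rewrite ge_min lexx orbT.
(* To the value [1 - eps], [up] adds [eps / 4] and [low1] and [low2] add [eps / 8] each. *)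
apply: le_trans (lerD hval h2) _.
rewrite sumrB big_split /= big_split /= sumr_const -/n.
by lra.
Qed.

(** * Conditioned Bernoulli sets and the edges between them *)

(* [A (i |: S)] has the law of [A S] conditioned on [i \in S], so the inner sum
   divided by the probability of [A] is the factor by which conditioning on [A]
   changes the probability of [i \in S]. *)
Lemma bern_tilt (R : realType) (I : finType) (q h : R) (A : pred {set I}) (u : I -> R) :
  0 <= q <= 1 -> expR (- h) <= \sum_(S | A S) bern q S ->
  q * (\sum_i (\sum_(S : {set I} | A (i |: S)) bern q S) * u i) <=
    (\sum_(S | A S) bern q S) * (h + q * \sum_i (expR (u i) - 1)).
Proof.
move=> q01 hA.
have := gibbs (fun S => bern_ge0 S q01) hA (bern_mgf u q01).
apply: le_trans; rewrite le_eqVlt; apply/orP; left; apply/eqP.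
under [RHS]eq_bigr do rewrite mulr_sumr.
rewrite [RHS](exchange_big_dep predT) //= mulr_sumr; apply: eq_bigr => i _.
rewrite -mulr_suml mulrA; congr (_ * _).
rewrite big_mkcond /= [RHS]big_mkcond /=.
transitivity (q * \sum_(S : {set I}) bern q S * (A (i |: S))%:R).
  by congr (_ * _); apply: eq_bigr => S _; case: (A _); rewrite ?mulr1 ?mulr0.
rewrite -(bern_plant q i (fun S => (A S)%:R)) big_mkcond /=; apply: eq_bigr => S _.
by case: (A S); case: (i \in S); rewrite ?mulr1 ?mulr0.
Qed.

(** [bern_mgf] with the nonpositive weights [- lam * D i / d]. As [D i / d] lies in the unit
    interval, its square in the second-order term is at most itself. *)
Lemma bern_mgf_lower (R : realType) (I : finType) (q lam d : R) (D : I -> R) :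
  0 <= q <= 1 -> 0 <= lam -> 0 < d -> (forall i, 0 <= D i <= d) ->
  \sum_(S : {set I}) bern q S * expR (- (lam / d * \sum_(i in S) D i)) <=
    expR (- (q * (lam - lam ^+ 2) / d * \sum_i D i)).
Proof.
move=> q01 l0 d0 hD; have dn : d != 0 by rewrite gt_eqF.
have := bern_mgf (fun i => - (lam / d * D i)) q01.
under eq_bigr do rewrite sumrN -mulr_sumr.
move=> H; apply: le_trans H _; rewrite ler_expR.
have /andP[q0 _] := q01.
rewrite [leRHS](_ : _ = q * \sum_i - ((lam - lam ^+ 2) * (D i / d))); last first.
  by rewrite sumrN -mulr_sumr -mulr_suml; ring.
rewrite ler_wpM2l//; apply: ler_sum => i _.
have /andP[D0 D1] := hD i.
rewrite mulrAC -mulrA; set z := D i / d; have z01 : 0 <= z <= 1.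
  by rewrite /z divr_ge0 ?(ltW d0)//= ler_pdivrMr// mul1r.
have /andP[z0 z1] := z01.
have hz : - (lam * z) <= 0 by rewrite oppr_le0 mulr_ge0.
have hq : 0 <= lam ^+ 2 * (z * (1 - z)).
  by apply: mulr_ge0; [exact: sqr_ge0 | apply: mulr_ge0 => //; rewrite subr_ge0].
by have := expR_le_quad_neg hz; rewrite sqrrN exprMn; move: hq; rewrite !expr2; lra.
Qed.

Definition edges_in (R : realType) (X Y : finType) (E : {set X * Y}) (S : {set X}) (T : {set Y}) : R :=
  \sum_(e in E) (e.1 \in S)%:R * (e.2 \in T)%:R.

(** Average over [T] with [S] fixed: each [y] has at most [d] neighbours in [S], and what remains is
    the degree sum of [S] at rate [lam']. Averaging over [S] uses the same bound; each stage costs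
    at most one [lam ^+ 2]. *)
Lemma edges_mgf_lower (R : realType) (X Y : finType) (E : {set X * Y}) (q q' lam d : R) :
  0 <= q <= 1 -> 0 <= q' <= 1 -> 0 <= lam <= 1 -> 0 < d ->
  (forall x, \sum_y ((x, y) \in E)%:R <= d) ->
  (forall y, \sum_x ((x, y) \in E)%:R <= d) ->
  \sum_S \sum_T bern q S * bern q' T * expR (- (lam / d * edges_in R E S T)) <=
    expR (- ((lam - 2 * lam ^+ 2) * (q * q' * #|E|%:R / d))).
Proof.
move=> q01 q01' /andP[l0 l1] d0 hX hY.
have l2 : lam ^+ 2 <= lam by rewrite expr2 ler_piMr.
have /andP[q0 q1] := q01; have /andP[q0' q1'] := q01'.
pose lam' := q' * (lam - lam ^+ 2).
have l0' : 0 <= lam' by rewrite mulr_ge0// subr_ge0.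
have step S : \sum_T bern q S * bern q' T * expR (- (lam / d * edges_in R E S T)) <=
    bern q S * expR (- (lam' / d * \sum_(x in S) \sum_y ((x, y) \in E)%:R)).
  under eq_bigr do rewrite -mulrA; rewrite -mulr_sumr ler_wpM2l ?bern_ge0//.
  pose D y : R := \sum_(x in S) ((x, y) \in E)%:R.
  have hD y : 0 <= D y <= d.
    rewrite sumr_ge0 //=; apply: le_trans (hY y).
    rewrite /D big_mkcond; apply: ler_sum => x _.
    by case: ifP.
  have := bern_mgf_lower q01' l0 d0 hD.
  rewrite [X in _ -> _ <= expR (- (_ * X))]exchange_big /=; apply: le_trans.
  rewrite le_eqVlt; apply/orP; left; apply/eqP.
  apply: eq_bigr => T _; congr (_ * expR (- (_ * _))).
  rewrite /edges_in (sum_edges E (fun x y => (x \in S)%:R * (y \in T)%:R)) exchange_big /=.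
  rewrite [RHS]big_mkcond; apply: eq_bigr => y _; rewrite /D.
  case: (y \in T); last by rewrite big1 // => x _; rewrite !mulr0.
  rewrite [RHS]big_mkcond; apply: eq_bigr => x _; rewrite mulr1.
  by case: (x \in S); rewrite ?mulr1 ?mulr0.
apply: (@le_trans _ _ (\sum_S bern q S * expR (- (lam' / d * \sum_(x in S) \sum_y ((x, y) \in E)%:R)))).
  by apply: ler_sum => S _; apply: step.
pose D x : R := \sum_y ((x, y) \in E)%:R.
have hD x : 0 <= D x <= d by rewrite sumr_ge0 //= hX.
apply: (le_trans (bern_mgf_lower q01 l0' d0 hD)); rewrite /D.
have -> : \sum_x \sum_y ((x, y) \in E)%:R = #|E|%:R :> R.
  have := sum_edges E (fun _ _ => 1 : R); rewrite sumr_const => ->.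
  by apply: eq_bigr => x _; apply: eq_bigr => y _; rewrite mulr1.
rewrite ler_expR lerN2 [leLHS](_ : _ = q * (q' * (lam - 2 * lam ^+ 2)) * (#|E|%:R / d)); last by ring.
rewrite [leRHS](_ : _ = q * (lam' - lam' ^+ 2) * (#|E|%:R / d)); last by ring.
rewrite ler_wpM2r ?divr_ge0 ?(ltW d0)// ler_wpM2l//.
have : lam' ^+ 2 <= q' * lam ^+ 2; last by rewrite /lam'; lra.
rewrite /lam' exprMn ler_pM ?sqr_ge0//; first by rewrite expr2 ler_piMr.
by rewrite lerXn2r ?nnegrE ?subr_ge0// lerBlDr lerDl sqr_ge0.
Qed.

Definition pair_pr (R : realType) (X Y : finType) (q q' : R)
    (W : {set X} -> {set Y} -> bool) : R :=
  \sum_S \sum_T bern q S * bern q' T * (W S T)%:R.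

(** Linearity over the edges and [bern_plant] on each side: counting the asked edges on an event
    becomes planting each edge in turn. *)
Lemma pair_pr_plant (R : realType) (X Y : finType) (E : {set X * Y}) (q q' : R)
    (W : {set X} -> {set Y} -> bool) :
  \sum_S \sum_T bern q S * bern q' T * (W S T)%:R * edges_in R E S T =
  q * q' * \sum_(e in E) pair_pr q q' (fun S T => W (e.1 |: S) (e.2 |: T)).
Proof.
rewrite mulr_sumr; under eq_bigr => S _ do under eq_bigr => T _ do rewrite mulr_sumr.
under eq_bigr => S _ do rewrite exchange_big.
rewrite exchange_big /=; apply: eq_bigr => -[x y] _ /=.
transitivity (\sum_(S : {set X} | x \in S) bern q S *
   (\sum_(T : {set Y} | y \in T) bern q' T * (W S T)%:R)).
  rewrite [RHS]big_mkcond /=; apply: eq_bigr => S _.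
  case: (x \in S); last by rewrite big1 // => T _; rewrite mul0r mulr0.
  rewrite mulr_sumr [RHS]big_mkcond /=; apply: eq_bigr => T _.
  by case: (y \in T); rewrite ?mulr1 ?mulr0 // !mulrA.
rewrite (bern_plant q x (fun S => \sum_(T : {set Y} | y \in T) bern q' T * (W S T)%:R)).
rewrite -mulrA; congr (_ * _); rewrite mulr_sumr; apply: eq_bigr => S _.
rewrite (bern_plant q' y (fun T => (W (x |: S) T)%:R)) mulrCA; congr (_ * _).
by rewrite mulr_sumr; apply: eq_bigr => T _; rewrite mulrA.
Qed.

Lemma pair_pr_rect (R : realType) (X Y : finType) (q q' : R)
    (A : pred {set X}) (B : pred {set Y}) :
  pair_pr q q' (fun S T => A S && B T) =
  (\sum_(S | A S) bern q S) * (\sum_(T | B T) bern q' T).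
Proof.
rewrite /pair_pr big_distrlr /= [RHS]big_mkcond; apply: eq_bigr => S _.
case: (A S); last by rewrite big1 // => T _; rewrite mulr0.
by rewrite [RHS]big_mkcond; apply: eq_bigr => T _; case: (B T); rewrite ?mulr1 ?mulr0.
Qed.

Lemma ler_pair_pr (R : realType) (X Y : finType) (q q' : R) (V W : {set X} -> {set Y} -> bool) :
  0 <= q <= 1 -> 0 <= q' <= 1 -> (forall S T, V S T -> W S T) ->
  pair_pr q q' V <= pair_pr q q' W.
Proof.
move=> q01 q01' VW; apply: ler_sum => S _; apply: ler_sum => T _.
rewrite ler_wpM2l ?mulr_ge0 ?bern_ge0 // ler_nat.
by case: (V S T) (VW S T) => // ->.
Qed.

(** By [bern_plant] the left side is the weight of the sets in [A] that contain [i]. This supplies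
    the bound by 1 on marginals in [rectangle_step]. *)
Lemma bern_marginal_le1 (R : realType) (I : finType) (q : R) (A : pred {set I}) (i : I) :
  0 <= q <= 1 ->
  q * \sum_(S : {set I} | A (i |: S)) bern q S <= \sum_(S | A S) bern q S.
Proof.
move=> q01.
have -> : \sum_(S : {set I} | A (i |: S)) bern q S = \sum_(S : {set I}) bern q S * (A (i |: S))%:R.
  by rewrite big_mkcond; apply: eq_bigr => S _; case: (A _); rewrite ?mulr1 ?mulr0.
rewrite -(bern_plant q i (fun S => (A S)%:R)) big_mkcond [leRHS]big_mkcond /=.
apply: ler_sum => S _; have := bern_ge0 S q01.
by case: (i \in S); case: (A S); rewrite ?mulr1 ?mulr0.
Qed.

(** [gibbs] applied to a negative multiple of the edge count, with [edges_mgf_lower]: an event of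
    probability at least [expR (- h)] cannot make edges rare. With [lam = eps / 48] the entropy and
    the second-order term each cost a small multiple of [eps]. *)
Lemma edges_lower (R : realType) (X Y : finType) (E : {set X * Y}) (eps q q' h d : R)
    (W : {set X} -> {set Y} -> bool) :
  0 < eps <= 1 -> 0 < q <= 1 -> 0 < q' <= 1 -> 0 < d -> (0 < #|E|%:R :> R) ->
  (forall x, \sum_y ((x, y) \in E)%:R <= d) ->
  (forall y, \sum_x ((x, y) \in E)%:R <= d) ->
  h * d = eps ^+ 2 * (q * q' * #|E|%:R) / 40 ^+ 2 ->
  expR (- h) <= pair_pr q q' W ->
  (1 - eps / 4) * (q * q' * #|E|%:R) * pair_pr q q' W <=
    \sum_S \sum_T bern q S * bern q' T * (W S T)%:R * edges_in R E S T.
Proof.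
move=> /andP[e0 e1] /andP[q0 q1] /andP[q0' q1'] d0 n0 hX hY hh hW.
have q01 : 0 <= q <= 1 by rewrite ltW.
have q01' : 0 <= q' <= 1 by rewrite ltW.
pose lam := eps / 48.
have l01 : 0 <= lam <= 1 by rewrite /lam; apply/andP; split; lra.
have dn : d != 0 by rewrite gt_eqF.
pose w (u : {set X} * {set Y}) := bern q u.1 * bern q' u.2.
pose F (u : {set X} * {set Y}) := - (lam / d * edges_in R E u.1 u.2).
pose A (u : {set X} * {set Y}) := W u.1 u.2.
have w0 u : 0 <= w u by rewrite mulr_ge0 ?bern_ge0.
have sumA (G : {set X} -> {set Y} -> R) : \sum_(u | A u) w u * G u.1 u.2 =
    \sum_S \sum_T bern q S * bern q' T * (W S T)%:R * G S T.
  rewrite pair_big /= big_mkcond; apply: eq_bigr => -[S T] _ /=.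
  by rewrite /A /w /=; case: (W S T); rewrite ?mulr1 ?mulr0 ?mul0r.
have pA : \sum_(u | A u) w u = pair_pr q q' W.
  have := sumA (fun _ _ => 1); under eq_bigr do rewrite mulr1; move=> ->.
  by apply: eq_bigr => S _; apply: eq_bigr => T _; rewrite mulr1.
have hA : expR (- h) <= \sum_(u | A u) w u by rewrite pA.
have hM := edges_mgf_lower q01 q01' l01 d0 hX hY.
rewrite pair_big /= in hM.
have := gibbs w0 hA hM.
rewrite pA (sumA (fun S T => - (lam / d * edges_in R E S T))).
set om := pair_pr q q' W; set n : R := #|E|%:R in n0 hh *.
set N := \sum_S \sum_T _ * edges_in R E S T.
rewrite [X in X <= _ -> _](_ : _ = - (lam / d * N)); last first.
  rewrite /N mulr_sumr -sumrN; apply: eq_bigr => S _.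
  by rewrite mulr_sumr -sumrN; apply: eq_bigr => T _; ring.
have om0 : 0 <= om by apply: le_trans hW; exact: expR_ge0.
rewrite -(ler_pM2r d0) [X in X <= _ -> _](_ : _ = - (lam * N)); last by field.
rewrite [X in _ <= X -> _](_ : _ = om * (h * d - (lam - 2 * lam ^+ 2) * (q * q' * n))); last by field.
rewrite hh => H.
have := mulr_ge0 om0 (mulr_ge0 (sqr_ge0 eps) (mulr_ge0 (mulr_ge0 (ltW q0) (ltW q0')) (ltW n0))).
set M := q * q' * n in H *.
move=> H0; suff : 0 <= eps * (N - (1 - eps / 4) * M * om) by rewrite pmulr_rge0// subr_ge0.
have H0' : 0 <= om * eps ^+ 2 * M by rewrite -mulrA.
have e2 : om * (eps ^+ 2 * M / 40 ^+ 2 - (lam - 2 * lam ^+ 2) * M) =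
   (om * eps ^+ 2 * M) * (1 / 40 ^+ 2 + 2 / 48 ^+ 2) - eps * (om * M) / 48.
  by rewrite /lam; field.
rewrite e2 in H.
have e3 : eps * (N - (1 - eps / 4) * M * om) =
  48 * (lam * N) - eps * (om * M) + (om * eps ^+ 2 * M) / 4 by rewrite /lam; field.
by rewrite e3; lra.
Qed.

(** * Revealing planted edges one after the other *)

Lemma pair_pr_sum (R : realType) (X Y I J : finType) (q q' : R) (c : I -> J -> R)
    (W : I -> J -> {set X} -> {set Y} -> bool) :
  \sum_i \sum_j c i j * pair_pr q q' (W i j) =
  \sum_S \sum_T bern q S * bern q' T * (\sum_i \sum_j c i j * (W i j S T)%:R).
Proof.
rewrite pair_big /=.
under eq_bigr do rewrite mulr_sumr.
rewrite exchange_big /=; apply: eq_bigr => S _.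
under eq_bigr do rewrite mulr_sumr.
rewrite exchange_big /=; apply: eq_bigr => T _.
rewrite pair_big mulr_sumr; apply: eq_bigr => u _ /=; ring.
Qed.

(* Induction on the number [m] of revealed edges. If the winning part of the
   rectangle [A x B] has probability at least [exp (- h)], it contains on average
   almost the expected number of edges; planting a uniformly random edge and
   splitting the rectangle according to its two answers leaves only the accepted
   answer pairs, which costs a factor [1 - eps / 2] by [rectangle_step]. *)
Lemma birthday_pr_le (R : realType) (X Y SX SY : finType) (E : {set X * Y})
    (P : X -> Y -> SX -> SY -> bool) (eps q q' h d : R) :
  leq 1 #|SX| -> leq 1 #|SY| -> 0 < eps <= 1 -> 0 < q <= 1 / 2 -> 0 < q' <= 1 / 2 ->
  (forall (f : {ffun X -> SX}) (g : {ffun Y -> SY}),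
     \sum_(e in E) (P e.1 e.2 (f e.1) (g e.2))%:R <= (1 - eps) * #|E|%:R) ->
  0 < d -> (0 < #|E|%:R :> R) ->
  (forall x, \sum_y ((x, y) \in E)%:R <= d) ->
  (forall y, \sum_x ((x, y) \in E)%:R <= d) ->
  0 <= h -> h * d = eps ^+ 2 * (q * q' * #|E|%:R) / 40 ^+ 2 ->
  forall m (a : {set X} -> {ffun X -> SX}) (b : {set Y} -> {ffun Y -> SY})
    (A : pred {set X}) (B : pred {set Y}),
  pair_pr q q' (fun S T => [&& A S, B T & birthday_pred E P S T (a S) (b T)]) <=
    (1 - eps / 4) ^+ m * ((\sum_(S | A S) bern q S) * (\sum_(T | B T) bern q' T)) +
    (2 * (#|SX| * #|SY|)%:R) ^+ m * expR (- h).
Proof.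
move=> SX0 SY0 he hq hq' hv d0 n0 hX hY h0 hh.
have /andP[e0 e1] := he; have /andP[q0 q1] := hq; have /andP[q0' q1'] := hq'.
have hq1 : 0 < q <= 1 by rewrite q0; lra.
have hq1' : 0 < q' <= 1 by rewrite q0'; lra.
have q01 : 0 <= q <= 1 by rewrite ltW //=; lra.
have q01' : 0 <= q' <= 1 by rewrite ltW //=; lra.
set K : R := (#|SX| * #|SY|)%:R.
have K1 : 1 <= K by rewrite /K ler1n muln_gt0 SX0.
have et : 0 <= 1 - eps / 4 by lra.
elim=> [|m IH] a b A B.
  rewrite !expr0 !mul1r -pair_pr_rect.
  apply: (@le_trans _ _ (pair_pr q q' (fun S T => A S && B T))).
    by apply: ler_pair_pr => // S T /and3P[-> ->].
  by rewrite lerDl expR_ge0.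
set W := fun S T => [&& A S, B T & birthday_pred E P S T (a S) (b T)].
set om := pair_pr q q' W.
set pA := \sum_(S | A S) bern q S; set pB := \sum_(T | B T) bern q' T.
set th := expR (- h).
have th0 : 0 < th by exact: expR_gt0.
have pA0 : 0 <= pA by apply: sumr_ge0 => S _; exact: bern_ge0.
have pB0 : 0 <= pB by apply: sumr_ge0 => T _; exact: bern_ge0.
have ple1 (I : finType) (r : R) (C : pred {set I}) : 0 <= r <= 1 -> \sum_(S | C S) bern r S <= 1.
  move=> r01; rewrite -(bern_sum1 I r) big_mkcond; apply: ler_sum => S _.
  by case: (C S) => //; exact: bern_ge0.
(* Below the threshold the error term alone suffices, as [2 * K] is at least 1. Above it, each side
   of the rectangle has probability at least [th], which [bern_tilt] requires. *)
have [small|big] := leP om th.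
  apply: (le_trans small); rewrite -[leLHS]add0r lerD ?mulr_ge0 ?exprn_ge0 //.
  by rewrite -[leLHS]mul1r ler_pM2r // exprn_ege1 //; lra.
have omAB : om <= pA * pB.
  by rewrite -pair_pr_rect; apply: ler_pair_pr => // S T /and3P[-> ->].
have thA : th <= pA.
  by apply: le_trans (le_trans (ltW big) omAB) _; rewrite ler_piMr // ple1.
have thB : th <= pB.
  by apply: le_trans (le_trans (ltW big) omAB) _; rewrite ler_piMl // ple1.
have pA_gt0 : 0 < pA by apply: lt_le_trans thA.
have pB_gt0 : 0 < pB by apply: lt_le_trans thB.
have low := edges_lower he hq1 hq1' d0 n0 hX hY hh (ltW big).
rewrite pair_pr_plant in low; fold om in low.
set n : R := #|E|%:R in n0 hh hv low.
(* Divided by [pA], this is the density relative to [q] of the event that [x] is asked and answered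
   by [s], given [A]. *)
pose al x s := \sum_(S : {set X} | A (x |: S) && (a (x |: S) x == s)) bern q S.
pose be y t := \sum_(T : {set Y} | B (y |: T) && (b (y |: T) y == t)) bern q' T.
have al0 x s : 0 <= al x s by apply: sumr_ge0 => S _; exact: bern_ge0.
have be0 y t : 0 <= be y t by apply: sumr_ge0 => S _; exact: bern_ge0.
set eta := (1 - eps / 4) ^+ m in IH; set sm := (2 * K) ^+ m in IH.
have sm0 : 0 <= sm by rewrite exprn_ge0 // mulr_ge0 //; lra.
have eta0 : 0 <= eta by rewrite exprn_ge0.
have step x y : (x, y) \in E ->
    pair_pr q q' (fun S T => W (x |: S) (y |: T)) <=
    \sum_s \sum_t (eta * (al x s * be y t * (P x y s t)%:R) + sm * th).
  move=> xyE.
  (* Sort by the answers to the planted edge: a win forces [P x y s t], and it restricts to a win on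
     [S] and [T]. *)
  apply: (@le_trans _ _ (\sum_s \sum_t (P x y s t)%:R *
     pair_pr q q' (fun S T => [&& A (x |: S) && (a (x |: S) x == s),
        B (y |: T) && (b (y |: T) y == t) & birthday_pred E P S T (a (x |: S)) (b (y |: T))]))).
    rewrite (pair_pr_sum _ _ (fun s t => (P x y s t)%:R)).
    apply: ler_sum => S _; apply: ler_sum => T _.
    have w0 : 0 <= bern q S * bern q' T by rewrite mulr_ge0 ?bern_ge0.
    have [|_] := boolP (W (x |: S) (y |: T)); last first.
      rewrite mulr0 mulr_ge0 //; apply: sumr_ge0 => s _; apply: sumr_ge0 => t _.
      by rewrite mulr_ge0.
    case/and3P=> hA hB /forall_inP hwin.
    rewrite ler_wpM2l // (bigD1 (a (x |: S) x)) //= (bigD1 (b (y |: T) y)) //=.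
    have -> : P x y (a (x |: S) x) (b (y |: T) y).
      by have := hwin (x, y) xyE; rewrite /= !finset.setU11.
    have -> : birthday_pred E P S T (a (x |: S)) (b (y |: T)).
      apply/forall_inP => e eE; apply/implyP => /andP[eS eT].
      have := hwin e eE; rewrite !finset.in_setU eS eT !orbT.
      by move=> /implyP; apply.
    rewrite hA hB !eqxx mulr1 -addrA lerDl addr_ge0 //.
      by apply: sumr_ge0 => t _; rewrite mulr_ge0.
    by apply: sumr_ge0 => s _; apply: sumr_ge0 => t _; rewrite mulr_ge0.
  apply: ler_sum => s _; apply: ler_sum => t _.
  case: (P x y s t); last by rewrite mul0r !mulr0 add0r mulr_ge0 ?(ltW th0).
  rewrite mul1r mulr1.
  (* Planting and fixing the answers again gives strategies and a rectangle, now of probability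
     [al x s * be y t]; this is why the induction ranges over all [a], [b], [A], [B]. *)
  exact: (IH (fun S => a (x |: S)) (fun T => b (y |: T))
    (fun S => A (x |: S) && (a (x |: S) x == s)) (fun T => B (y |: T) && (b (y |: T) y == t))).
have sumal x : \sum_s al x s = \sum_(S : {set X} | A (x |: S)) bern q S.
  by rewrite (partition_big (fun S : {set X} => a (x |: S) x) predT).
have sumbe y : \sum_t be y t = \sum_(T : {set Y} | B (y |: T)) bern q' T.
  by rewrite (partition_big (fun T : {set Y} => b (y |: T) y) predT).
have rect : \sum_(e in E) \sum_s \sum_t al e.1 s / pA * (be e.2 t / pB) * (P e.1 e.2 s t)%:R <=
    (1 - eps / 2) * n.
  apply: (@rectangle_step R X Y SX SY E P eps q q' h d (fun x s => al x s / pA)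
    (fun y t => be y t / pB)) => //.
  - by move=> x s; rewrite divr_ge0.
  - by move=> y t; rewrite divr_ge0.
  - move=> u; rewrite -(ler_pM2l pA_gt0).
    apply: le_trans (bern_tilt u q01 thA).
    rewrite mulrCA le_eqVlt; apply/orP; left; apply/eqP; congr (_ * _).
    rewrite mulr_sumr.
    apply: eq_bigr => x _; rewrite -mulr_suml sumal; field.
    by rewrite gt_eqF.
  - move=> u; rewrite -(ler_pM2l pB_gt0).
    apply: le_trans (bern_tilt u q01' thB).
    rewrite mulrCA le_eqVlt; apply/orP; left; apply/eqP; congr (_ * _).
    rewrite mulr_sumr.
    apply: eq_bigr => x _; rewrite -mulr_suml sumbe; field.
    by rewrite gt_eqF.
  - move=> y; rewrite -mulr_suml sumbe mulrA ler_pdivrMr // mul1r.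
    exact: bern_marginal_le1.
have addc (F : SX -> SY -> R) c : \sum_s \sum_t (F s t + c) = \sum_s \sum_t F s t + K * c.
  under eq_bigr do rewrite big_split sumr_const /=.
  by rewrite big_split /= sumr_const -mulrnA mulnC /K mulr_natl.
have tot : \sum_(e in E) pair_pr q q' (fun S T => W (e.1 |: S) (e.2 |: T)) <=
    eta * ((1 - eps / 2) * n * (pA * pB)) + n * (K * (sm * th)).
  apply: (@le_trans _ _ (\sum_(e in E) (\sum_s \sum_t eta * (al e.1 s * be e.2 t * (P e.1 e.2 s t)%:R) + K * (sm * th)))).
    apply: ler_sum => -[x y] xyE /=; apply: le_trans (step x y xyE) _.
    by rewrite addc.
  rewrite big_split /= sumr_const -[X in _ + X]mulr_natl -/n lerD2r.
  under eq_bigr => e _ do under eq_bigr => s _ do rewrite -mulr_sumr.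
  under eq_bigr => e _ do rewrite -mulr_sumr.
  rewrite -mulr_sumr ler_wpM2l //.
  rewrite -ler_pdivrMr ?mulr_gt0 //; apply: le_trans rect.
  rewrite mulr_suml le_eqVlt; apply/orP; left; apply/eqP; apply: eq_bigr => e _.
  rewrite mulr_suml; apply: eq_bigr => s _; rewrite mulr_suml; apply: eq_bigr => t _.
  by field; rewrite !gt_eqF.
have qq0 : 0 < q * q' by rewrite mulr_gt0.
rewrite -(ler_pM2l qq0) in tot.
have {low tot} H := le_trans low tot.
have {}H : (1 - eps / 4) * om <= eta * ((1 - eps / 2) * (pA * pB)) + K * (sm * th).
  rewrite -(ler_pM2l (mulr_gt0 qq0 n0)); apply: le_trans (le_trans _ H) _; rewrite le_eqVlt.
    by apply/orP; left; apply/eqP; ring.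
  by apply/orP; left; apply/eqP; ring.
have et0 : 0 < 1 - eps / 4 by lra.
(* Undo the factor [1 - eps / 4] lost in [edges_lower]: [1 - eps / 2] is at most its square, so one
   factor survives, and the 2 in [2 * K] absorbs the division in the error term. *)
rewrite -(ler_pM2l et0); apply: (le_trans H).
rewrite !exprS -/eta -/sm mulrDr lerD //.
  rewrite !mulrA [leLHS](_ : _ = (1 - eps / 2) * (eta * pA * pB)); last by ring.
  rewrite [leRHS](_ : _ = (1 - eps / 4) ^+ 2 * (eta * pA * pB)); last by ring.
  rewrite ler_wpM2r ?mulr_ge0 //.
  by have := sqr_ge0 eps; rewrite !expr2; lra.
rewrite [leRHS](_ : _ = (2 * (1 - eps / 4)) * (K * (sm * th))); last by ring.
rewrite ler_peMl ?mulr_ge0 ?(ltW th0) //; lra.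
Qed.

(** * From uniformly random [k]-sets to Bernoulli sets *)

Lemma bern_card (R : realType) (I : finType) (q : R) (S : {set I}) :
  bern q S = q ^+ #|S| * (1 - q) ^+ (#|I| - #|S|).
Proof.
rewrite /bern (bigID (mem S)) /= -(finset.cardsC S) addKn; congr (_ * _).
  by rewrite (eq_bigr (fun=> q)) ?prodr_const // => i ->.
rewrite (eq_bigr (fun=> 1 - q)) => [|i /negbTE -> //].
by rewrite prodr_const; congr (_ ^+ _); apply: eq_card => i; rewrite !inE.
Qed.

Lemma bern_mean (R : realType) (I : finType) (q : R) :
  \sum_(S : {set I}) bern q S * #|S|%:R = q * #|I|%:R.
Proof.
transitivity (\sum_(i : I) \sum_(S : {set I} | i \in S) bern q S * 1).
  rewrite (exchange_big_dep predT) //=; apply: eq_bigr => S _.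
  by rewrite sumr_const mulr1 mulr_natr.
under eq_bigr => i _ do rewrite (bern_plant q i (fun=> 1)) -mulr_suml bern_sum1 mulr1 mulr1.
by rewrite sumr_const mulr_natr.
Qed.

(** Markov's inequality: the mean size is [k / 2], so a size of at least [k.+1] has probability at
    most one half. *)
Lemma bern_card_le (R : realType) (I : finType) (q : R) (k : nat) :
  0 <= q <= 1 -> q * #|I|%:R = k%:R / 2 ->
  1 / 2 <= \sum_(S : {set I} | leq #|S| k) bern q S.
Proof.
move=> q01 hq; have := bern_sum1 I q.
rewrite (bigID (fun S : {set I} => leq #|S| k)) /=.
set p := \sum_(S | _) _; set p' := \sum_(S | _) _.
have p0 : 0 <= p' by apply: sumr_ge0 => S _; exact: bern_ge0.
have : k.+1%:R * p' <= k%:R / 2.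
  rewrite -hq -bern_mean mulr_sumr big_mkcond; apply: ler_sum => S _.
  have b0 := bern_ge0 S q01.
  case: ifP => [|_]; last by rewrite mulr_ge0.
  by rewrite -ltnNge => hk; rewrite mulrC ler_wpM2l // ler_nat.
rewrite -natr1 mulrDl mul1r => H1 H2.
have : 0 <= k%:R :> R by rewrite ler0n.
move: H1 H2; set c : R := k%:R; move=> H1 H2 c0.
have [//|hp] := leP (1 / 2) p.
have : c * (p' - 1 / 2) >= 0 by rewrite mulr_ge0 //; lra.
by lra.
Qed.

(** Complements turn [k]-supersets of [S] into subsets of [~: S] of size [#|I| - k]. In this form
    the binomial vanishes for [#|S| > k], which [k - #|S|] with truncated subtraction would not
    give. *)
Lemma card_supersets (I : finType) (S : {set I}) (k : nat) : leq k #|I| ->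
  #|[set U : {set I} | (S \subset U) && (#|U| == k)]| = 'C(#|I| - #|S|, #|I| - k).
Proof.
move=> kI; rewrite -(finset.cardsC S) addKn finset.cardsC -cards_draws.
rewrite -(card_imset _ (@finset.setC_inj I)); apply: eq_card => U.
rewrite inE; apply/imsetP/andP => [[V]|[US /eqP cU]].
  rewrite inE => /andP[SV /eqP cV] ->; rewrite finset.setCS; split => //.
  by rewrite -(finset.cardsC V) cV addKn.
exists (~: U); last by rewrite finset.setCK.
rewrite inE -finset.setCS finset.setCK US /=; apply/eqP.
have := finset.cardsC U; rewrite cU => hc.
by apply/eqP; rewrite -(eqn_add2l (#|I| - k)) hc subnK.
Qed.

(* [p S U] is the joint law of a Bernoulli set [S] and a uniformly random
   [k]-superset [U] of [S], restricted to the event [#|S| <= k]. *)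
Lemma bern_extension (R : realType) (I : finType) (q : R) (k : nat) :
  0 <= q <= 1 -> q * #|I|%:R = k%:R / 2 -> leq k #|I| ->
  exists p : {set I} -> {set I} -> R,
  [/\ forall S U, 0 <= p S U,
      forall S U : {set I}, ~~ (S \subset U) -> p S U = 0,
      forall S : {set I}, \sum_U p S U <= bern q S &
      forall U : {set I}, #|U| = k -> 1 / 2 <= 'C(#|I|, k)%:R * \sum_S p S U].
Proof.
move=> q01 hq kI; set n := #|I|.
(* The weight of a [j]-set spread evenly over its [k]-supersets. For [k < j <= n] there are none:
   the binomial is 0, and so is [phi j]. *)
pose phi j : R := q ^+ j * (1 - q) ^+ (n - j) / 'C(n - j, n - k)%:R.
have phi0 j : 0 <= phi j.
  have /andP[q0 q1] := q01.
  by rewrite divr_ge0 // mulr_ge0 // exprn_ge0 // subr_ge0.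
pose p (S U : {set I}) : R := ((S \subset U) && (#|U| == k))%:R * phi #|S|.
have rowE S : \sum_U p S U = 'C(n - #|S|, n - k)%:R * phi #|S|.
  rewrite -mulr_suml; congr (_ * _); rewrite -card_supersets // -sum1_card natr_sum.
  by rewrite [RHS]big_mkcond; apply: eq_bigr => U _; rewrite inE; case: ifP.
have rowle S : \sum_U p S U <= bern q S.
  rewrite rowE bern_card -/n /phi.
  have [->|nz] := eqVneq ('C(n - #|S|, n - k)%:R : R) 0.
    by rewrite mul0r -bern_card bern_ge0.
  by rewrite mulrC divfK.
have roweq (S : {set I}) : leq #|S| k -> \sum_U p S U = bern q S.
  move=> Sk; rewrite rowE bern_card -/n /phi mulrC divfK //.
  by rewrite pnatr_eq0 -lt0n bin_gt0 leq_sub2l.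
(* By symmetry all [k]-sets receive the same mass, so ['C(n, k)] times it is the total mass, the
   probability that [#|S| <= k]. *)
have colE (U : {set I}) : #|U| = k -> \sum_S p S U = \sum_(j < k.+1) 'C(k, j)%:R * phi j.
  move=> Uk; rewrite /p Uk eqxx.
  transitivity (\sum_(S : {set I} | S \subset U) phi #|S|).
    rewrite [RHS]big_mkcond; apply: eq_bigr => S _.
    by case: (S \subset U); rewrite ?mul1r ?mul0r.
  rewrite (partition_big (fun S : {set I} => inord #|S| : 'I_k.+1) predT) //=.
  apply: eq_bigr => j _.
  rewrite (eq_bigr (fun=> phi j)) => [|S /andP[SU /eqP <-]]; last first.
    by rewrite inordK // ltnS -Uk subset_leq_card.
  have -> : 'C(k, j) = #|[set S : {set I} | (S \subset U) && (#|S| == j)]|.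
    by rewrite cards_draws Uk.
  rewrite sumr_const mulr_natl; congr (_ *+ _).
  apply: eq_card => S; rewrite !inE [LHS]unfold_in.
  case SU: (S \subset U) => //=.
  by rewrite -val_eqE /= inordK // ltnS -Uk subset_leq_card.
exists p; split => //.
- by move=> S U; rewrite mulr_ge0.
- by move=> S U /negbTE; rewrite /p => ->; rewrite /= mul0r.
move=> U Uk; apply: le_trans (bern_card_le q01 hq) _.
have -> : 'C(n, k)%:R * \sum_S p S U = \sum_(V : {set I} | #|V| == k) \sum_S p S V.
  rewrite [RHS](eq_bigr (fun=> \sum_S p S U)) => [|V /eqP Vk]; last by rewrite (colE V Vk) (colE U Uk).
  rewrite sumr_const -card_draws mulr_natl; congr (_ *+ _).
  by apply: eq_card => V; rewrite inE.
rewrite exchange_big /= big_mkcond; apply: ler_sum => S _.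
have -> : \sum_(V : {set I} | #|V| == k) p S V = \sum_V p S V.
  rewrite big_mkcond; apply: eq_bigr => V _; case: ifP => // Vk.
  by rewrite /p Vk andbF mul0r.
case: ifP => [/roweq -> //|_].
by apply: sumr_ge0 => V _; rewrite mulr_ge0.
Qed.

Lemma birthday_pred_subset (X Y SX SY : finType) (E : {set X * Y})
    (P : X -> Y -> SX -> SY -> bool) (S U : {set X}) (T V : {set Y}) a b :
  S \subset U -> T \subset V -> birthday_pred E P U V a b -> birthday_pred E P S T a b.
Proof.
move=> /fintype.subsetP SU /fintype.subsetP TV /forall_inP h; apply/forall_inP => e eE.
by apply/implyP => /andP[/SU eU /TV eV]; have := h e eE; rewrite eU eV.
Qed.

(** A prover asked [S] may answer as [f] does on a random [k]-superset; a win on larger questions is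
    a win on smaller ones. Each pair of questions is reached with at least a quarter of its uniform
    probability, and [best_response] fixes the supersets, first for [S], then for [T]. *)
Lemma birthday_to_bern (R : realType) (X Y SX SY : finType) (E : {set X * Y})
    (P : X -> Y -> SX -> SY -> bool) (q q' : R) (k l : nat)
    (f : {ffun {set X} -> {ffun X -> SX}}) (g : {ffun {set Y} -> {ffun Y -> SY}}) :
  0 <= q <= 1 -> 0 <= q' <= 1 ->
  q * #|X|%:R = k%:R / 2 -> q' * #|Y|%:R = l%:R / 2 -> leq k #|X| -> leq l #|Y| ->
  exists (a : {set X} -> {ffun X -> SX}) (b : {set Y} -> {ffun Y -> SY}),
  \sum_(u in birthday_questions X Y k l) (birthday_pred E P u.1 u.2 (f u.1) (g u.2))%:R <=
    4 * #|birthday_questions X Y k l|%:R *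
    pair_pr q q' (fun S T => birthday_pred E P S T (a S) (b T)).
Proof.
move=> q01 q01' hq hq' kX lY.
have [p [p0 pS prow pcol]] := bern_extension q01 hq kX.
have [p' [p0' pS' prow' pcol']] := bern_extension q01' hq' lY.
have cardQ : #|birthday_questions X Y k l| = muln 'C(#|X|, k) 'C(#|Y|, l).
  rewrite -!card_draws -finset.cardsX; apply: eq_card => -[S T].
  by rewrite !inE.
pose F S U := \sum_T \sum_V p' T V * (birthday_pred E P S T (f U) (g V))%:R.
have F0 S U : 0 <= F S U by apply: sumr_ge0 => T _; apply: sumr_ge0 => V _; rewrite mulr_ge0.
have X0 : leq 1 #|{set X}| by apply/card_gt0P; exists finset.set0.
have Y0 : leq 1 #|{set Y}| by apply/card_gt0P; exists finset.set0.
have [s hs] := best_response X0 p0 prow F0.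
pose G T V := \sum_S bern q S * (birthday_pred E P S T (f (s S)) (g V))%:R.
have G0 T V : 0 <= G T V by apply: sumr_ge0 => S _; rewrite mulr_ge0 ?bern_ge0.
have [s' hs'] := best_response Y0 p0' prow' G0.
exists (fun S => f (s S)), (fun T => g (s' T)).
have -> : pair_pr q q' (fun S T => birthday_pred E P S T (f (s S)) (g (s' T))) =
    \sum_T bern q' T * G T (s' T).
  rewrite /pair_pr exchange_big; apply: eq_bigr => T _.
  by rewrite mulr_sumr; apply: eq_bigr => S _; rewrite -mulrA mulrCA.
have c0 : 0 <= 4 * #|birthday_questions X Y k l|%:R :> R by rewrite mulr_ge0.
apply: le_trans (ler_wpM2l c0 hs').
have -> : \sum_T \sum_V p' T V * G T V = \sum_S bern q S * F S (s S).
  under [RHS]eq_bigr do rewrite mulr_sumr.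
  rewrite [RHS]exchange_big; apply: eq_bigr => T _.
  under [RHS]eq_bigr do rewrite mulr_sumr.
  rewrite [RHS]exchange_big; apply: eq_bigr => V _.
  by rewrite mulr_sumr; apply: eq_bigr => S _; rewrite mulrCA.
apply: le_trans (ler_wpM2l c0 hs).
have -> : \sum_S \sum_U p S U * F S U = \sum_U \sum_V \sum_S \sum_T
    p S U * p' T V * (birthday_pred E P S T (f U) (g V))%:R.
  rewrite exchange_big; apply: eq_bigr => U _.
  rewrite [RHS]exchange_big; apply: eq_bigr => S _.
  rewrite [RHS]exchange_big mulr_sumr; apply: eq_bigr => T _.
  by rewrite mulr_sumr; apply: eq_bigr => V _; rewrite mulrA.
rewrite (sum_edges (birthday_questions X Y k l) (fun U V => (birthday_pred E P U V (f U) (g V))%:R)).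
rewrite mulr_sumr; apply: ler_sum => U _; rewrite mulr_sumr; apply: ler_sum => V _.
have pp0 : 0 <= \sum_S \sum_T p S U * p' T V * (birthday_pred E P S T (f U) (g V))%:R.
  by apply: sumr_ge0 => S _; apply: sumr_ge0 => T _; rewrite !mulr_ge0.
case: (boolP ((U, V) \in _)) => [|_]; last by rewrite mul0r mulr_ge0.
rewrite inE /= => /andP[/eqP Uk /eqP Vl].
case: (boolP (birthday_pred E P U V _ _)) => [win|_]; last by rewrite mulr0 mulr_ge0.
have -> : \sum_S \sum_T p S U * p' T V * (birthday_pred E P S T (f U) (g V))%:R =
    (\sum_S p S U) * (\sum_T p' T V).
  rewrite big_distrlr /=; apply: eq_bigr => S _; apply: eq_bigr => T _.
  have [SU|/pS ->] := boolP (S \subset U); last by rewrite !mul0r.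
  have [TV|/pS' ->] := boolP (T \subset V); last by rewrite mulr0 mul0r.
  by rewrite (birthday_pred_subset SU TV win) mulr1.
rewrite cardQ natrM.
have h1 := pcol U Uk; have h2 := pcol' V Vl.
have h0 : 0 <= 1 / 2 :> R by lra.
have := ler_pM h0 h0 h1 h2.
set c1 : R := 'C(_, k)%:R; set c2 : R := 'C(_, l)%:R; set s1 := \sum_S _; set s2 := \sum_T _.
by rewrite mulr1n; lra.
Qed.

(** * Bounds on the value and the choice of parameters *)

Lemma uval_ge (QX QY AX AY : finType) (Q : {set QX * QY}) (V : QX -> QY -> AX -> AY -> bool)
    (f : {ffun QX -> AX}) (g : {ffun QY -> AY}) :
  \sum_(q in Q) (V q.1 q.2 (f q.1) (g q.2))%:R <= uval Q V * #|Q|%:R.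
Proof.
have [Q0|Qn] := eqVneq (#|Q|%:R : R) 0.
  rewrite Q0 mulr0; move/eqP: Q0; rewrite pnatr_eq0 cards_eq0 => /eqP ->.
  by rewrite big1 // => q; rewrite inE.
have Qp : 0 < #|Q|%:R :> R by rewrite lt0r Qn ler0n.
rewrite -ler_pdivrMr //; apply: le_trans (le_bigmax _ _ f).
exact: (le_bigmax _ _ g).
Qed.

Lemma uval_le (QX QY AX AY : finType) (Q : {set QX * QY}) (V : QX -> QY -> AX -> AY -> bool) (v : R) :
  0 <= v -> (forall (f : {ffun QX -> AX}) (g : {ffun QY -> AY}),
    \sum_(q in Q) (V q.1 q.2 (f q.1) (g q.2))%:R <= v * #|Q|%:R) ->
  uval Q V <= v.
Proof.
move=> v0 hv; apply: bigmax_le => // f _; apply: bigmax_le => // g _.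
have [Q0|Qn] := eqVneq (#|Q|%:R : R) 0; first by rewrite Q0 invr0 mulr0.
by rewrite ler_pdivrMr // lt0r Qn ler0n.
Qed.

Lemma uval_ge0 (QX QY AX AY : finType) (Q : {set QX * QY}) (V : QX -> QY -> AX -> AY -> bool) :
  0 <= uval Q V.
Proof. exact: bigmax_ge_id. Qed.

Lemma ln2_ge_half (R : realType) : 1 / 2 <= exp.ln (2 : R).
Proof.
rewrite -ler_expR lnK ?posrE //.
by apply: le_trans (expR_le_quad (lexx _)) _; rewrite expr2; lra.
Qed.

(** Take [m] as the integer part of [h / (4 * ln K)]. As [2 * K <= K ^+ 2], the second term is at
    most [expR (- h / 2)]; in the first, rounding down costs at most [expR (eps / 4) <= 2]. *)
Lemma optimize_rounds (R : realType) (K eps h : R) :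
  2 <= K -> 0 < eps <= 1 -> 0 <= h ->
  exists m, (1 - eps / 4) ^+ m + (2 * K) ^+ m * expR (- h) <=
    3 * expR (- (eps * h / (16 * exp.ln K))).
Proof.
move=> K2 /andP[e0 e1] h0.
have K0 : 0 < K by lra.
set c := exp.ln K; have KE : K = expR c by rewrite /c lnK ?posrE.
have c2 : 1 / 2 <= c.
  by apply: le_trans (ln2_ge_half R) _; rewrite ler_ln ?posrE.
have c0 : 0 < c by lra.
clearbody c.
pose t := h / (4 * c).
have t0 : 0 <= t by rewrite divr_ge0 //; lra.
have htc : h = 4 * (c * t) by rewrite /t; field; rewrite gt_eqF.
have -> : eps * h / (16 * c) = eps * t / 4 by rewrite htc; field; rewrite gt_eqF.
have /andP[m1 m2] := truncn_itv t0; set m := Num.trunc t in m1 m2.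
exists m; rewrite -natr1 in m2; clearbody m t.
have ct : t / 2 <= c * t by rewrite mulrC ler_wpM2r //; lra.
have et : 0 <= eps * t by rewrite mulr_ge0 // ltW.
have et1 : eps * t <= t by rewrite ler_piMl.
have b2 : (2 * K) ^+ m * expR (- h) <= expR (- (eps * t / 4)).
  apply: (@le_trans _ _ (expR (2 * c) ^+ m * expR (- h))).
    rewrite ler_wpM2r ?expR_ge0 // lerXn2r ?nnegrE ?expR_ge0 //; first by lra.
    by rewrite expRM_natl -KE expr2 ler_wpM2r //; lra.
  rewrite -expRM_natl -exp.expRD ler_expR htc.
  have : m%:R * (2 * c) <= t * (2 * c) by rewrite ler_wpM2r //; lra.
  by lra.
have b1 : (1 - eps / 4) ^+ m <= 2 * expR (- (eps * t / 4)).
  apply: (@le_trans _ _ (expR (- (eps / 4)) ^+ m)).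
    rewrite lerXn2r ?nnegrE ?expR_ge0 //; first by lra.
    exact: expR_ge1Dx.
  rewrite -expRM_natl.
  apply: (@le_trans _ _ (expR (eps / 4) * expR (- (eps * t / 4)))).
    rewrite -exp.expRD ler_expR.
    have : eps * (t - m%:R) <= eps * 1 by rewrite ler_wpM2l //; lra.
    by lra.
  rewrite ler_wpM2r ?expR_ge0 //.
  have e4 : eps / 4 <= 1 / 2 by lra.
  apply: le_trans (expR_le_quad e4) _.
  by have := ler_pM (ltW e0) (ltW e0) e1 e1; rewrite !expr2; lra.
by lra.
Qed.

Lemma degree_le_dmax (R : realType) (X Y : finType) (E : {set X * Y}) :
  (forall x, \sum_y ((x, y) \in E)%:R <= (dmax E)%:R :> R) /\
  (forall y, \sum_x ((x, y) \in E)%:R <= (dmax E)%:R :> R).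
Proof.
split=> [x|y].
  have -> : \sum_y ((x, y) \in E)%:R = #|[set y | (x, y) \in E]|%:R :> R.
    rewrite -sum1_card natr_sum [RHS]big_mkcond; apply: eq_bigr => y _.
    by rewrite inE; case: ifP.
  rewrite ler_nat leq_max; apply/orP; left.
  exact: (leq_bigmax (F := fun x => #|[set y | (x, y) \in E]|)).
have -> : \sum_x ((x, y) \in E)%:R = #|[set x | (x, y) \in E]|%:R :> R.
  rewrite -sum1_card natr_sum [RHS]big_mkcond; apply: eq_bigr => x _.
  by rewrite inE; case: ifP.
rewrite ler_nat leq_max; apply/orP; right.
exact: (leq_bigmax (F := fun y => #|[set x | (x, y) \in E]|)).
Qed.

Lemma dmax_gt0 (R : realType) (X Y : finType) (E : {set X * Y}) :
  E != finset.set0 -> 0 < (dmax E)%:R :> R.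
Proof.
move=> /finset.set0Pn [[x y] xyE].
apply: lt_le_trans ((degree_le_dmax R E).1 x); rewrite (bigD1 y) //= xyE.
by rewrite ltr_wpDr // sumr_ge0.
Qed.

Lemma uval_le1 (QX QY AX AY : finType) (Q : {set QX * QY}) (V : QX -> QY -> AX -> AY -> bool) :
  uval Q V <= 1.
Proof.
apply: uval_le => // f g; rewrite mul1r -sum1_card natr_sum.
by apply: ler_sum => q _; rewrite ler_nat leq_b1.
Qed.

Lemma half_rate (R : realType) (k n : nat) : leq 1 k -> leq k n ->
  exists q : R, 0 < q <= 1 / 2 /\ q * n%:R = k%:R / 2.
Proof.
move=> k0 kn; have n0 : 0 < n%:R :> R by rewrite ltr0n (leq_trans k0).
exists (k%:R / 2 / n%:R); split; last by rewrite divfK // gt_eqF.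
rewrite ler_pdivrMr // [leRHS]mulrC mul1r ler_pM2r ?invr_gt0 // ler_nat kn.
by rewrite divr_gt0 // divr_gt0 // ltr0n.
Qed.

(** The constant 12 is 4 from [birthday_to_bern] times 3 from [optimize_rounds]. In the exponent,
    [320 ^+ 2] is [16 * 40 ^+ 2 * 4], the last 4 coming from the halved rates [q] and [q']. *)
Lemma birthday_sum_exp (R : realType) (X Y SX SY : finType) (E : {set X * Y})
    (P : X -> Y -> SX -> SY -> bool) (k l : nat) (eps : R) :
  E != finset.set0 -> leq 1 #|SX| -> leq 1 #|SY| -> leq 2 (muln #|SX| #|SY|) ->
  leq 1 k -> leq 1 l -> leq k #|X| -> leq l #|Y| -> 0 < eps <= 1 ->
  (forall (f : {ffun X -> SX}) (g : {ffun Y -> SY}),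
     \sum_(e in E) (P e.1 e.2 (f e.1) (g e.2))%:R <= (1 - eps) * #|E|%:R) ->
  forall (f : {ffun {set X} -> {ffun X -> SX}}) (g : {ffun {set Y} -> {ffun Y -> SY}}),
  \sum_(u in birthday_questions X Y k l) (birthday_pred E P u.1 u.2 (f u.1) (g u.2))%:R <=
    12 * expR (- (eps ^+ 3 * (k%:R * l%:R * #|E|%:R / ((dmax E)%:R * #|X|%:R * #|Y|%:R)) /
      (320 ^+ 2 * exp.ln (muln #|SX| #|SY|)%:R))) * #|birthday_questions X Y k l|%:R.
Proof.
move=> En SX0 SY0 K2 k0 l0 kX lY he hv f g.
have n0 : 0 < #|E|%:R :> R by rewrite ltr0n finset.card_gt0.
have X0 : 0 < #|X|%:R :> R by rewrite ltr0n (leq_trans k0).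
have Y0 : 0 < #|Y|%:R :> R by rewrite ltr0n (leq_trans l0).
have [hX hY] := degree_le_dmax R E.
have d0 := dmax_gt0 R En.
have [q [q0 hq]] := half_rate R k0 kX; have [q' [q0' hq']] := half_rate R l0 lY.
have q01 : 0 <= q <= 1 by case/andP: q0 => ? ?; apply/andP; split; lra.
have q01' : 0 <= q' <= 1 by case/andP: q0' => ? ?; apply/andP; split; lra.
have kE : k%:R = 2 * (q * #|X|%:R) :> R by rewrite hq mulrC divfK // pnatr_eq0.
have lE : l%:R = 2 * (q' * #|Y|%:R) :> R by rewrite hq' mulrC divfK // pnatr_eq0.
set K : R := (muln #|SX| #|SY|)%:R.
have hK : 2 <= K by rewrite /K ler_nat.
have c0 : 0 < exp.ln K by apply: ln_gt0; lra.
have [a [b hab]] := birthday_to_bern E P f g q01 q01' hq hq' kX lY.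
apply: le_trans hab _; rewrite kE lE.
have main := birthday_pr_le SX0 SY0 he q0 q0' hv d0 n0 hX hY.
move: main d0; set d : R := (dmax E)%:R; set n : R := #|E|%:R => main d0.
pose h := eps ^+ 2 * (q * q' * n) / 40 ^+ 2 / d.
have h0 : 0 <= h.
  case/andP: q01 => ? _; case/andP: q01' => ? _.
  apply: divr_ge0; last exact: ltW.
  apply: divr_ge0; last exact: exprn_ge0.
  apply: mulr_ge0; first exact: sqr_ge0.
  by rewrite mulr_ge0 ?(ltW n0) // mulr_ge0.
have hh : h * d = eps ^+ 2 * (q * q' * n) / 40 ^+ 2 by rewrite /h divfK // gt_eqF.
have [m hm] := optimize_rounds hK he h0.
have -> : eps ^+ 3 * (2 * (q * #|X|%:R) * (2 * (q' * #|Y|%:R)) * n / (d * #|X|%:R * #|Y|%:R)) /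
    (320 ^+ 2 * exp.ln K) = eps * h / (16 * exp.ln K).
  by rewrite /h; field; rewrite !gt_eqF.
have := main h h0 hh m a b predT predT.
rewrite !bern_sum1 !mulr1 => H.
have {H hm} := le_trans H hm.
set p := pair_pr _ _ _; set e := expR _ => H.
rewrite mulrAC; apply: ler_wpM2r => //.
by move: H; clearbody p e; lra.
Qed.

(** * From an exponential to a power of [1 - eps / 2], and conclusion *)

Lemma one_sub_half_ge_exp (R : realType) (eps : R) : 0 <= eps <= 1 -> expR (- eps) <= 1 - eps / 2.
Proof.
move=> /andP[e0 e1]; have y0 := expR_gt0 (- eps).
have h1 : (1 + eps) * expR (- eps) <= 1.
  by rewrite -[leRHS](expRxMexpNx_1 eps) ler_pM2r // expR_ge1Dx.
have h2 : 0 <= eps * (1 - eps) by rewrite mulr_ge0 // subr_ge0.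
have h3 : 0 < 1 + eps by lra.
by rewrite -(ler_pM2l h3); apply: le_trans h1 _; lra.
Qed.

(** Trades part of the exponent for the constant. With [y = expR (- z)]: if [y > 1 / 2] then [2 * y]
    exceeds 1; otherwise [12 * y ^+ 6] is at most [12 / 32 * y]. *)
Lemma absorb_constant (R : realType) (x z : R) :
  x <= 1 -> x <= 12 * expR (- (6 * z)) -> x <= 2 * expR (- z).
Proof.
move=> x1; rewrite -mulrN expRM_natl; set y := expR (- z) => hx.
have y0 : 0 < y by exact: expR_gt0.
have [hy|hy] := leP y (1 / 2); last by lra.
apply: le_trans hx _; rewrite exprS.
have : y ^+ 5 <= (1 / 2) ^+ 5 by apply: lerXn2r => //; rewrite nnegrE; lra.
rewrite -(ler_pM2l y0) !exprS expr0.
by set w := y * (y * _); lra.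
Qed.

Lemma decay_bound (R : realType) (x eps c k l n D : R) :
  x <= 1 -> 0 < eps <= 1 -> 1 / 2 <= c -> 0 <= k -> 0 <= l -> 0 <= n -> 0 < D ->
  x <= 12 * expR (- (eps ^+ 3 * (k * l * n / D) / (320 ^+ 2 * c))) ->
  x <= 2 * powR (1 - eps / 2) (1 / (20 * 320 ^+ 2) * eps ^+ 5 * k * l * n / (D * c ^+ 2)).
Proof.
move=> x1 /andP[e0 e1] c2 k0 l0 n0 D0.
have N0 : 0 < 320 ^+ 2 :> R by rewrite exprn_gt0.
move: N0; set N : R := 320 ^+ 2; clearbody N => N0.
have c0 : 0 < c by lra.
set r := k * l * n / D.
have r0 : 0 <= r by apply: divr_ge0; [apply: mulr_ge0 => //; apply: mulr_ge0 | exact: ltW].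
set ex := (X in powR _ X).
have exE : ex = 1 / (20 * N) * eps ^+ 5 * r / c ^+ 2.
  by rewrite /ex /r; field; rewrite !gt_eqF.
clearbody ex r.
have -> : eps ^+ 3 * r / (N * c) = 6 * (eps ^+ 3 * r / (6 * N * c)).
  by field; rewrite !gt_eqF.
move=> /(absorb_constant x1) H; apply: le_trans H _.
rewrite ler_pM2l //.
have z0 : 0 <= eps ^+ 3 * r / c.
  by apply: divr_ge0; [apply: mulr_ge0 => //; exact/exprn_ge0/ltW | exact: ltW].
have eexE : eps * ex = (eps ^+ 3 * r / c) * (eps ^+ 3 / (20 * N * c)).
  by rewrite exE; field; rewrite !gt_eqF.
(* The stated exponent is weaker than the proved one by a further [eps ^+ 2 / c]; with [eps <= 1]
   and [c >= 1 / 2], the constant 20 makes [20 * c] at least 6. *)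
have ez : eps ^+ 3 / (20 * N * c) <= 1 / (6 * N).
  rewrite ler_pdivrMr ?mulr_gt0 // [leRHS](_ : _ = 20 / 6 * c); last by field; rewrite gt_eqF.
  have : eps ^+ 3 <= 1 by rewrite exprn_ile1 // ltW.
  by lra.
have ex0 : 0 <= ex.
  rewrite -(pmulr_rge0 _ e0) eexE; apply: mulr_ge0 => //.
  by apply: divr_ge0; [exact/exprn_ge0/ltW | rewrite !mulr_ge0 // ltW].
apply: (@le_trans _ _ (powR (expR (- eps)) ex)); last first.
  apply: ge0_ler_powR => //; rewrite ?nnegrE ?expR_ge0 //; first by lra.
  by apply: one_sub_half_ge_exp; rewrite ltW.
rewrite -expRM ler_expR mulNr lerN2 eexE.
have -> : eps ^+ 3 * r / (6 * N * c) = (eps ^+ 3 * r / c) * (1 / (6 * N)).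
  by field; rewrite !gt_eqF.
exact: ler_wpM2l.
Qed.

Theorem theorem3p1 :
  exists alpha : R, 0 < alpha /\
  forall (X Y SX SY : finType) (E : {set X * Y})
         (P : X -> Y -> SX -> SY -> bool),
    E != finset.set0 -> leq 1 #|SX| -> leq 1 #|SY| ->
    forall k l : nat, leq k #|X| -> leq l #|Y| ->
    let eps : R := 1 - game_val E P in
    let c : R := ln ((#|SX| * #|SY|)%:R : R) in
    birthday_val E P k l <=
      2 * powR (1 - eps / 2)
        (alpha * eps ^+ 5 * k%:R * l%:R * (#|E|)%:R
          / ((dmax E)%:R * (#|X|)%:R * (#|Y|)%:R * c ^+ 2)).
Proof.
exists (1 / (20 * 320 ^+ 2)); split.
  by rewrite divr_gt0 // mulr_gt0 // exprn_gt0.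
move=> X Y SX SY E P En SX0 SY0 k l kX lY; cbv zeta.
set eps := 1 - game_val E P; set c := ln _.
have bv1 : birthday_val E P k l <= 1 by exact: uval_le1.
have e0 : 0 <= eps by rewrite /eps subr_ge0 uval_le1.
have e1 : eps <= 1 by rewrite /eps lerBlDr lerDl uval_ge0.
have cE : c = exp.ln (muln #|SX| #|SY|)%:R by rewrite /c RlnE.
(* In the degenerate cases the power is 1: the base is 1 for [eps = 0], the exponent is 0 for
   [k = 0] or [l = 0], and for a single answer pair [c = 0], where division by 0 gives exponent
   0. *)
have trivial_bound (b x : R) : powR b x = 1 -> birthday_val E P k l <= 2 * powR b x.
  by move=> ->; apply: (le_trans bv1); lra.
have [ez|en] := eqVneq eps 0.
  by apply: trivial_bound; rewrite ez mul0r subr0 powR1.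
have [kz|k0] := posnP k.
  by apply: trivial_bound; rewrite kz !(mulr0, mul0r) powRr0.
have [lz|l0] := posnP l.
  by apply: trivial_bound; rewrite lz !(mulr0, mul0r) powRr0.
have [K1|K2] := leqP (muln #|SX| #|SY|) 1.
  have cz : c = 0.
    rewrite cE (_ : muln _ _ = 1%nat) ?ln1 //; apply/eqP.
    by rewrite eqn_leq K1 muln_gt0 SX0.
  by apply: trivial_bound; rewrite cz expr0n /= !(mulr0, invr0) powRr0.
have he : 0 < eps <= 1 by rewrite lt0r en e0.
apply: decay_bound => //.
- by rewrite cE; apply: le_trans (ln2_ge_half _) _; rewrite ler_ln ?posrE ?ler_nat ?ltr0n // ltnW.
- by rewrite !mulr_gt0 ?dmax_gt0 // ltr0n; [exact: leq_trans kX | exact: leq_trans lY].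
apply: uval_le => [|f g]; first by rewrite mulr_ge0 ?expR_ge0.
rewrite cE; apply: birthday_sum_exp => // f' g'.
by rewrite /eps opprB addrC subrK; exact: uval_ge.
Qed.
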